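(* Let $C_1,C_2,C_3,C_5,C_6,C_7,\alpha_1,\alpha_2,\alpha_3$ be real constants with $\alpha_1\neq0$, $C_7\neq 0$ and $C_6\notin\{-1,-2,-3\}$, and set $$A(\rho)=C_1+\frac{C_5}{\rho^3}\left(C_3+\frac{C_7}{\rho}\right)^{C_6}.$$ The two relations $$t+\alpha_2+\frac{C_2-u}{\alpha_1\rho}+\frac{C_3u}{\alpha_1}=0$$ and $$0=x+\alpha_3+\frac{1}{\alpha_1}\Bigg(C_1\ln\rho-C_1C_3\rho+\frac{C_3u^2}{2}+\frac{u(C_2-u)}{\rho}-C_5\left(C_3+\frac{C_7}{\rho}\right)^{C_6+1}\cdot\frac{2\rho^2C_3^2-C_7^2(C_6+1)\left(C_3\rho(C_6+3)-C_6-2\right)+C_3C_7\rho\left(C_3\rho(C_6+3)-2C_6-2\right)}{(C_6+1)(C_6+2)(C_6+3)C_7^3\rho^2}\Bigg)$$ implicitly give a solution of the system $$u_t+uu_x+A(\rho)\rho_x=0,\qquad \rho_t+(\rho u)_x=0,\qquad u_x-\rho_x\,\frac{C_2-u}{\rho(C_3\rho-1)}=0.$$ That is, whenever smooth functions $u(t,x)$ and $\rho(t,x)$ on an open subset of $\mathbb R^2$, with $\rho>0$, $C_3+C_7/\rho>0$ and $C_3\rho\neq1$, satisfy both relations identically in $(t,x)$, they satisfy this system.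
   Context: The first two equations of the system are the one-dimensional Euler equations for a homentropic gas flow ($u$ is the velocity, $\rho$ the density, $A(\rho)=p'(\rho)/\rho$ with $p$ the pressure); the third is an added differential constraint. The two relations define a surface in the space of $(t,x,u,\rho)$, which in general is a multivalued solution: it need not project one-to-one to the $(t,x)$-plane. *)

(* Defs.v *)
(* Functions of (t, x) are total curried functions, time first; only their
   values on the open domain matter. *)
From Stdlib Require Import Reals.
From Coquelicot Require Import Coquelicot.

Open Scope R_scope.

(* [ex_diff_n f n t x] says that the iterated partial derivatives of [f] of
   order at most [n] exist and are continuous at (t, x); on an open set, having
   this for all [n] is being C^infinity. *)
Definition smooth_on (D : R * R -> Prop) (f : R -> R -> R) : Prop :=
  forall t x : R, D (t, x) -> forall n : nat, ex_diff_n f n t x.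

Definition Dt (f : R -> R -> R) (t x : R) : R := Derive (fun s => f s x) t.
Definition Dx (f : R -> R -> R) (t x : R) : R := Derive (fun y => f t y) x.

(* [Rpower a b] is [exp (b * ln a)], the real power for [a > 0]. *)
Definition A_fun (C1 C3 C5 C6 C7 rho : R) : R :=
  C1 + C5 / rho ^ 3 * Rpower (C3 + C7 / rho) C6.

Definition relation_t (C2 C3 a1 a2 t u rho : R) : Prop :=
  t + a2 + (C2 - u) / (a1 * rho) + C3 * u / a1 = 0.

Definition relation_x (C1 C2 C3 C5 C6 C7 a1 a3 x u rho : R) : Prop :=
  0 = x + a3 + 1 / a1 *
    (C1 * ln rho - C1 * C3 * rho + C3 * u ^ 2 / 2 + u * (C2 - u) / rho
     - C5 * Rpower (C3 + C7 / rho) (C6 + 1)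
       * ((2 * rho ^ 2 * C3 ^ 2
           - C7 ^ 2 * (C6 + 1) * (C3 * rho * (C6 + 3) - C6 - 2)
           + C3 * C7 * rho * (C3 * rho * (C6 + 3) - 2 * C6 - 2))
          / ((C6 + 1) * (C6 + 2) * (C6 + 3) * C7 ^ 3 * rho ^ 2))).

Definition solves_system_at (A : R -> R) (C2 C3 : R) (u rho : R -> R -> R)
    (t x : R) : Prop :=
  Dt u t x + u t x * Dx u t x + A (rho t x) * Dx rho t x = 0 /\
  Dt rho t x + Dx (fun s y => rho s y * u s y) t x = 0 /\
  Dx u t x
    - Dx rho t x * ((C2 - u t x) / (rho t x * (C3 * rho t x - 1))) = 0.

(* Main.v *)
(** Write the relations as [a1 (t + a2) + F (u, rho) = 0] and
    [a1 (x + a3) + G (u, rho) = 0]. Differentiating them in [t] and [x] says that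
    the Jacobian matrix of [(F, G)] times that of [(u, rho)] is [- a1] times the
    identity, so the Jacobian matrix of [(u, rho)] is explicit. In these terms the
    Euler equations are the hodograph equations [G_u = u F_u - rho F_rho] and
    [G_rho = u F_rho - A F_u], and the third equation is read off [F]. *)
Require Import Defs.
From Stdlib Require Import Reals Lra.
From Coquelicot Require Import Coquelicot.
Open Scope R_scope.

Definition pressure_term (C3 C5 C6 C7 r : R) : R :=
  C5 * Rpower (C3 + C7 / r) (C6 + 1)
  * ((2 * r ^ 2 * C3 ^ 2
      - C7 ^ 2 * (C6 + 1) * (C3 * r * (C6 + 3) - C6 - 2)
      + C3 * C7 * r * (C3 * r * (C6 + 3) - 2 * C6 - 2))
     / ((C6 + 1) * (C6 + 2) * (C6 + 3) * C7 ^ 3 * r ^ 2)).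

(** Substituting [b = C3 + C7 / r], so that [1 / r = (b - C3) / C7] and [dr / r ^ 2 = - db / C7],
    turns the stated derivative into [b ^ C6] times a quadratic in [b]. Integrating the three powers
    produces the factors [C6 + 1], [C6 + 2], [C6 + 3] and [C7 ^ 3] in the denominator. *)
Lemma is_derive_pressure_term (C3 C5 C6 C7 r : R) :
  C7 <> 0 -> C6 <> -1 -> C6 <> -2 -> C6 <> -3 ->
  0 < r -> 0 < C3 + C7 / r ->
  is_derive (pressure_term C3 C5 C6 C7) r
    (C5 / r ^ 3 * Rpower (C3 + C7 / r) C6 * (C3 - 1 / r)).
Proof.
  intros h7 h1 h2 h3 hr hb.
  assert (k1 : C6 + 1 <> 0) by lra.
  assert (k2 : C6 + 2 <> 0) by lra.
  assert (k3 : C6 + 3 <> 0) by lra.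
  assert (hr0 : r <> 0) by lra.
  assert (hb' : C3 * r + C7 <> 0).
  { replace (C3 * r + C7) with (r * (C3 + C7 / r)) by (field; exact hr0).
    apply Rmult_integral_contrapositive_currified; lra. }
  unfold pressure_term, Rpower.
  auto_derive.
  - repeat split; try assumption.
    repeat apply Rmult_integral_contrapositive_currified; lra.
  (* Splitting one factor [b] off [b ^ (C6 + 1)] leaves [b ^ C6] as the only transcendental atom, so
     the rest is an identity of rational functions. *)
  - replace ((C6 + 1) * ln (C3 + C7 * / r))
      with (C6 * ln (C3 + C7 / r) + ln (C3 + C7 / r)) by (unfold Rdiv; ring).
    replace ((C6 + 1) * ln (C3 + C7 / r))
      with (C6 * ln (C3 + C7 / r) + ln (C3 + C7 / r)) by ring.
    rewrite exp_plus, (exp_ln _ hb).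
    field; repeat split; assumption.
Qed.

(** Here [p] and [q] stand for [u] and [rho] along a line in the [t] or the [x] direction, so one
    chain rule serves both partial derivatives. The coefficients of [dp] and [dq] are [F_u] and
    [F_rho]. *)
Lemma is_derive_relation_t (C2 C3 : R) (p q : R -> R) (s dp dq : R) :
  is_derive p s dp -> is_derive q s dq -> 0 < q s ->
  is_derive (fun z => (C2 - p z) / q z + C3 * p z) s
    ((C3 - 1 / q s) * dp - (C2 - p s) / q s ^ 2 * dq).
Proof.
  intros hp hq h.
  auto_derive.
  - repeat split; try (eexists; eassumption); lra.
  - rewrite (is_derive_unique (fun z : R => p z) _ _ hp),
        (is_derive_unique (fun z : R => q z) _ _ hq).
    field; lra.
Qed.

(** The coefficients are arranged to show the hodograph form: [u F_u - rho F_rho] at [dp] and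
    [u F_rho - A F_u] at [dq]. The logarithmic and linear terms supply the constant part [C1] of
    [A], and [pressure_term] supplies the rest. *)
Lemma is_derive_relation_x (C1 C2 C3 C5 C6 C7 : R) (p q : R -> R)
    (s dp dq : R) :
  C7 <> 0 -> C6 <> -1 -> C6 <> -2 -> C6 <> -3 ->
  is_derive p s dp -> is_derive q s dq -> 0 < q s -> 0 < C3 + C7 / q s ->
  is_derive
    (fun z => C1 * ln (q z) - C1 * C3 * q z + C3 * p z ^ 2 / 2
              + p z * (C2 - p z) / q z - pressure_term C3 C5 C6 C7 (q z)) s
    ((p s * (C3 - 1 / q s) + (C2 - p s) / q s) * dp
     - (p s * ((C2 - p s) / q s ^ 2)
        + A_fun C1 C3 C5 C6 C7 (q s) * (C3 - 1 / q s)) * dq).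
Proof.
  intros h7 h1 h2 h3 hp hq h hb.
  assert (hP := is_derive_comp (pressure_term C3 C5 C6 C7) q s _ _
    (is_derive_pressure_term C3 C5 C6 C7 (q s) h7 h1 h2 h3 h hb) hq).
  assert (hL : is_derive (fun z => C1 * ln (q z) - C1 * C3 * q z
      + C3 * p z ^ 2 / 2 + p z * (C2 - p z) / q z) s
    ((C1 / q s - C1 * C3 - p s * (C2 - p s) / q s ^ 2) * dq
     + (C3 * p s + (C2 - 2 * p s) / q s) * dp)).
  { auto_derive.
    - repeat split; try (eexists; eassumption); lra.
    - rewrite (is_derive_unique (fun z : R => p z) _ _ hp),
        (is_derive_unique (fun z : R => q z) _ _ hq).
      field; lra. }
  refine (eq_ind _ (fun l => is_derive _ s l) (is_derive_minus _ _ _ _ _ hL hP) _ _).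
  unfold A_fun, minus, plus, opp, scal; simpl; unfold mult; simpl.
  field; lra.
Qed.

Lemma is_derive_locally_affine (f : R -> R) (s a b l : R) :
  is_derive f s l -> locally s (fun z => f z = a * z + b) -> l = a.
Proof.
  intros hf hloc.
  apply is_derive_unique in hf.
  rewrite <- hf, (Derive_ext_loc _ _ _ hloc).
  apply is_derive_unique.
  auto_derive; [exact I | ring].
Qed.

Lemma open_locally_fst (D : R * R -> Prop) (t x : R) :
  open D -> D (t, x) -> locally t (fun s => D (s, x)).
Proof.
  intros hD h.
  destruct (hD _ h) as [e he].
  exists e; intros s hs; apply he; split; [exact hs | apply ball_center].
Qed.

Lemma open_locally_snd (D : R * R -> Prop) (t x : R) :
  open D -> D (t, x) -> locally x (fun y => D (t, y)).
Proof.
  intros hD h.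
  destruct (hD _ h) as [e he].
  exists e; intros s hs; apply he; split; [apply ball_center | exact hs].
Qed.

Lemma smooth_on_partials (D : R * R -> Prop) (f : R -> R -> R) (t x : R) :
  smooth_on D f -> D (t, x) ->
  is_derive (fun s => f s x) t (Dt f t x) /\
  is_derive (fun y => f t y) x (Defs.Dx f t x).
Proof.
  intros hf h.
  destruct (hf t x h 1%nat) as [_ [h1 [h2 _]]].
  split; apply Derive_correct; assumption.
Qed.

(** Cramer's rule. Invertibility comes from the equations themselves: the two determinants multiply
    to [a * a], which is nonzero. *)
Lemma jacobian_solve (a Fu Fr Gu Gr ut ux rt rx : R) :
  a <> 0 ->
  Fu * ut + Fr * rt = - a -> Fu * ux + Fr * rx = 0 ->
  Gu * ut + Gr * rt = 0 -> Gu * ux + Gr * rx = - a ->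
  exists k, ut = k * Gr /\ ux = - k * Fr /\ rt = - k * Gu /\ rx = k * Fu.
Proof.
  intros ha e1 e2 e3 e4.
  assert (hdet : (Fu * Gr - Fr * Gu) * (ut * rx - ux * rt) = a * a).
  { transitivity ((Fu * ut + Fr * rt) * (Gu * ux + Gr * rx)
      - (Fu * ux + Fr * rx) * (Gu * ut + Gr * rt)); [ring |].
    rewrite e1, e2, e4; ring. }
  assert (hd : Fu * Gr - Fr * Gu <> 0).
  { intro h0; rewrite h0, Rmult_0_l in hdet.
    symmetry in hdet; apply Rmult_integral in hdet; tauto. }
  exists (- a / (Fu * Gr - Fr * Gu)).
  repeat split; apply (Rmult_eq_reg_l (Fu * Gr - Fr * Gu)); try exact hd.
  - transitivity (Gr * - a); [| field; exact hd].
    rewrite <- e1; transitivity (Gr * (Fu * ut + Fr * rt) - Fr * 0); [| ring].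
    rewrite <- e3; ring.
  - transitivity (- Fr * - a); [| field; exact hd].
    rewrite <- e4; transitivity (Gr * 0 - Fr * (Gu * ux + Gr * rx)); [| ring].
    rewrite <- e2; ring.
  - transitivity (- Gu * - a); [| field; exact hd].
    rewrite <- e1; transitivity (Fu * 0 - Gu * (Fu * ut + Fr * rt)); [| ring].
    rewrite <- e3; ring.
  - transitivity (Fu * - a); [| field; exact hd].
    rewrite <- e4; transitivity (Fu * (Gu * ux + Gr * rx) - Gu * 0); [| ring].
    rewrite <- e2; ring.
Qed.

Lemma relation_t_normal (C2 C3 a1 a2 t u r : R) :
  a1 <> 0 -> 0 < r -> relation_t C2 C3 a1 a2 t u r ->
  (C2 - u) / r + C3 * u = - a1 * t + - a1 * a2.
Proof.
  unfold relation_t; intros ha hr h.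
  replace ((C2 - u) / r + C3 * u)
    with (a1 * (t + a2 + (C2 - u) / (a1 * r) + C3 * u / a1) - a1 * t - a1 * a2)
    by (field; lra).
  rewrite h; ring.
Qed.

Lemma relation_x_normal (C1 C2 C3 C5 C6 C7 a1 a3 x u r : R) :
  a1 <> 0 -> relation_x C1 C2 C3 C5 C6 C7 a1 a3 x u r ->
  C1 * ln r - C1 * C3 * r + C3 * u ^ 2 / 2 + u * (C2 - u) / r
  - pressure_term C3 C5 C6 C7 r = - a1 * x + - a1 * a3.
Proof.
  unfold relation_x, pressure_term; intros ha h.
  match type of h with 0 = x + a3 + 1 / a1 * ?g => set (G := g) in * end.
  change (G = - a1 * x + - a1 * a3).
  replace G with (a1 * (x + a3 + 1 / a1 * G) - a1 * x - a1 * a3)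
    by (field; exact ha).
  rewrite <- h; ring.
Qed.

Theorem mainTheorem3
  (C1 C2 C3 C5 C6 C7 a1 a2 a3 : R)
  (ha1 : a1 <> 0) (hC7 : C7 <> 0)
  (hC6_1 : C6 <> -1) (hC6_2 : C6 <> -2) (hC6_3 : C6 <> -3)
  (D : R * R -> Prop) (hD : open D)
  (u rho : R -> R -> R)
  (hu : smooth_on D u) (hrho : smooth_on D rho)
  (hrho_pos : forall t x : R, D (t, x) -> 0 < rho t x)
  (hbase_pos : forall t x : R, D (t, x) -> 0 < C3 + C7 / rho t x)
  (hC3rho : forall t x : R, D (t, x) -> C3 * rho t x <> 1)
  (hrel_t : forall t x : R, D (t, x) ->
     relation_t C2 C3 a1 a2 t (u t x) (rho t x))
  (hrel_x : forall t x : R, D (t, x) ->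
     relation_x C1 C2 C3 C5 C6 C7 a1 a3 x (u t x) (rho t x)) :
  forall t x : R, D (t, x) ->
    solves_system_at (A_fun C1 C3 C5 C6 C7) C2 C3 u rho t x.
Proof.
  intros t x h.
  destruct (smooth_on_partials D u t x hu h) as [hut hux].
  destruct (smooth_on_partials D rho t x hrho h) as [hrt hrx].
  assert (hr := hrho_pos t x h).
  assert (hb := hbase_pos t x h).
  assert (hc := hC3rho t x h).
  assert (Lt := open_locally_fst D t x hD h).
  assert (Lx := open_locally_snd D t x hD h).
  assert (hprod : Defs.Dx (fun s y => rho s y * u s y) t x
      = Defs.Dx rho t x * u t x + rho t x * Defs.Dx u t x).
  { apply Derive_mult; eexists; eassumption. }
  assert (e1 := is_derive_relation_t C2 C3 (fun s => u s x) (fun s => rho s x)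
    t _ _ hut hrt hr).
  (* Near the point [F] equals [- a1 * (t + a2)] and [G] equals [- a1 * (x + a3)], so the slopes in
     the four cases are [- a1] for [F] in [t] and [G] in [x], and [0] otherwise. *)
  apply (is_derive_locally_affine _ t (- a1) (- a1 * a2)) in e1.
  2: { revert Lt; apply filter_imp; intros s hs.
       apply relation_t_normal; auto. }
  assert (e2 := is_derive_relation_t C2 C3 (fun y => u t y) (fun y => rho t y)
    x _ _ hux hrx hr).
  apply (is_derive_locally_affine _ x 0 (- a1 * t + - a1 * a2)) in e2.
  2: { revert Lx; apply filter_imp; intros y hy.
       rewrite (relation_t_normal C2 C3 a1 a2 t); auto; ring. }
  assert (e3 := is_derive_relation_x C1 C2 C3 C5 C6 C7 (fun s => u s x)
    (fun s => rho s x) t _ _ hC7 hC6_1 hC6_2 hC6_3 hut hrt hr hb).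
  apply (is_derive_locally_affine _ t 0 (- a1 * x + - a1 * a3)) in e3.
  2: { revert Lt; apply filter_imp; intros s hs.
       rewrite (relation_x_normal C1 C2 C3 C5 C6 C7 a1 a3 x); auto; ring. }
  assert (e4 := is_derive_relation_x C1 C2 C3 C5 C6 C7 (fun y => u t y)
    (fun y => rho t y) x _ _ hC7 hC6_1 hC6_2 hC6_3 hux hrx hr hb).
  apply (is_derive_locally_affine _ x (- a1) (- a1 * a3)) in e4.
  2: { revert Lx; apply filter_imp; intros y hy.
       apply relation_x_normal; auto. }
  unfold solves_system_at; rewrite hprod.
  cbv beta in e1, e2, e3, e4.
  (* From here [A] enters only as a number. *)
  generalize dependent (A_fun C1 C3 C5 C6 C7 (rho t x)).
  intros A e3 e4.
  destruct (jacobian_solve a1 (C3 - 1 / rho t x)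
      (- ((C2 - u t x) / rho t x ^ 2))
      (u t x * (C3 - 1 / rho t x) + (C2 - u t x) / rho t x)
      (- (u t x * ((C2 - u t x) / rho t x ^ 2) + A * (C3 - 1 / rho t x)))
      (Dt u t x) (Defs.Dx u t x) (Dt rho t x) (Defs.Dx rho t x) ha1)
    as (k & -> & -> & -> & ->); try lra.
  (* Each equation is now [k] times an identity between the coefficients; in the third,
     [C3 * rho - 1] cancels against [F_u = (C3 * rho - 1) / rho]. *)
  repeat split; field; repeat split; lra.
Qed.
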